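(* Let $\mathcal H^2$ be a two-dimensional complex Hilbert space with orthonormal basis $h_{01},h_{02}$, and let $\lambda_1,\lambda_2,\mu_1,\mu_2\in\mathbb C$ with $\operatorname{Im}\lambda_j>0$ and $\operatorname{Im}\mu_j\ge0$ for $j=1,2$. For $j=1,2$ let $T_j$ be the linear operator in $\mathcal H^2$ with matrix $\begin{pmatrix}\lambda_j&0\\0&\mu_j\end{pmatrix}$ in this basis, let $K_j:\mathbb C^2\to\mathcal H^2$ be given by $K_j(c_1,c_2)^T=\sqrt{\operatorname{Im}\lambda_j}\,c_1h_{01}+\sqrt{\operatorname{Im}\mu_j}\,c_2h_{02}$, let $J=I$ be the identity on $\mathbb C^2$, and consider the canonical L-systems $$\Theta_1=\begin{pmatrix}T_1&K_1&J\\ \mathcal H^2&&\mathbb C^2\end{pmatrix},\qquad \Theta_2=\begin{pmatrix}T_2&K_2&J\\ \mathcal H^2&&\mathbb C^2\end{pmatrix},$$ with c-Entropies $\mathcal S_1$ and $\mathcal S_2$, respectively. Let $\Theta=\Theta_1\cdot\Theta_2$ be the coupling of $\Theta_1$ and $\Theta_2$. Then the c-Entropy $\mathcal S$ of $\Theta$ satisfies $$\mathcal S=\mathcal S_1+\mathcal S_2.$$ If either $\mathcal S_1=\infty$ or $\mathcal S_2=\infty$, then $\mathcal S=\infty$.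
   Context: $\operatorname{Im}T=\frac1{2i}(T-T^* )$. A canonical L-system is an array $\Theta=\begin{pmatrix}T&K&J\\ \mathcal H&&E\end{pmatrix}$, where $\mathcal H,E$ are Hilbert spaces with $\dim E<\infty$, $T$ is a bounded operator in $\mathcal H$ (main operator), $K:E\to\mathcal H$ is bounded (channel operator), $J$ is a bounded self-adjoint unitary operator in $E$ (directing operator), and $\operatorname{Im}T=KJK^*$. Its transfer function is $W_\Theta(z)=I-2iK^*(T-zI)^{-1}KJ$, $z\in\rho(T)$. The c-Entropy of $\Theta$ is $\mathcal S=-\operatorname{tr}\ln(|W_\Theta(-i)|)$, where $|W|=(W^*W)^{1/2}$, with the convention $\ln 0=-\infty$ (so $\mathcal S=+\infty$ when $W_\Theta(-i)$ is singular). The coupling $\Theta=\Theta_1\cdot\Theta_2$ of $\Theta_1=\begin{pmatrix}T_1&K_1&J\\ \mathcal H^2&&\mathbb C^2\end{pmatrix}$ and $\Theta_2=\begin{pmatrix}T_2&K_2&J\\ \mathcal H^2&&\mathbb C^2\end{pmatrix}$ (with $J=I$) is the L-system $\Theta=\begin{pmatrix}\mathbf T&\mathbf K&J\\ \mathcal H^2\oplus\mathcal H^2&&\mathbb C^2\end{pmatrix}$, where $\mathbf T=\begin{pmatrix}T_1&2iK_1JK_2^*\\0&T_2\end{pmatrix}$ on $\mathcal H^2\oplus\mathcal H^2$ and $\mathbf K:\mathbb C^2\to\mathcal H^2\oplus\mathcal H^2$, $\mathbf K\mathbf c=(K_1\mathbf c,K_2\mathbf c)$, so that $\mathbf K^*(\mathbf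 h_1,\mathbf h_2)=K_1^*\mathbf h_1+K_2^*\mathbf h_2$. *)

(* Defs.v *)
From HB Require Import structures.
From mathcomp Require Import all_boot all_order all_algebra.
From mathcomp Require Import sesquilinear.
From mathcomp Require Import classical_sets reals ereal exp.
From mathcomp Require Import complex.

Set Implicit Arguments.
Unset Strict Implicit.
Unset Printing Implicit Defensive.

Import Order.TTheory GRing.Theory Num.Theory.
Local Open Scope ring_scope.

(* Finite-dimensional complex Hilbert spaces. Completeness and boundedness of
   linear operators are automatic; [inner] is linear in its first argument and
   conjugate-linear in its second one. *)
HB.mixin Record Vector_isHilbert (C : numClosedFieldType) H of Vector C H := {
  inner_subdef : {dot H for @Num.conj C}
}.

#[short(type="hilbertType")]
HB.structure Definition Hilbert (C : numClosedFieldType) :=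
  {H of Vector C H & Vector_isHilbert C H}.

Definition inner {C : numClosedFieldType} {H : hilbertType C} :
  {dot H for @Num.conj C} := @inner_subdef C H.

Notation "''[' u , v ]" := (inner u v)
  (format "''[' u ,  v ]") : ring_scope.

Section ColumnSpace.
Variables (C : numClosedFieldType) (n : nat).

Definition cvdot (u v : 'cV[C]_n) : C := \sum_i u i 0 * (v i 0)^*.

Lemma cvdot_bilinear : bilinear_for *%R (Num.conj \; *%R) cvdot.
Proof.
split=> [w|w] a u v; rewrite /cvdot /= mulr_sumr -big_split /=;
  apply: eq_bigr => i _; rewrite !mxE.
  by rewrite mulrDl mulrA.
by rewrite rmorphD rmorphM mulrDr mulrCA.
Qed.
HB.instance Definition _ := bilinear_isBilinear.Build C _ _ _ *%R
  (Num.conj \; *%R) cvdot cvdot_bilinear.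

Lemma cvdot_hermitian u v : cvdot u v = (-1) ^+ false * (cvdot v u)^*.
Proof.
rewrite expr0 mul1r /cvdot rmorph_sum; apply: eq_bigr => i _.
rewrite rmorphM /=. by rewrite conjCK mulrC.
Qed.
HB.instance Definition _ := isHermitianSesquilinear.Build C _ false
  Num.conj cvdot cvdot_hermitian.

Lemma cvdot_gt0 u : u != 0 -> 0 < cvdot u u.
Proof.
move=> u0; rewrite lt_def sumr_ge0 ?andbT => [|i _]; last exact: mul_conjC_ge0.
apply: contra u0 => /eqP /psumr_eq0P u0.
apply/eqP/matrixP => i j; rewrite (ord1 j) mxE; apply/eqP.
by rewrite -mul_conjC_eq0 u0 // => k _; exact: mul_conjC_ge0.
Qed.
HB.instance Definition _ := isDotProduct.Build C _ cvdot cvdot_gt0.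

HB.instance Definition _ := Vector_isHilbert.Build C 'cV[C]_n cvdot.

End ColumnSpace.

Section DirectSum.
Variables (C : numClosedFieldType) (H1 H2 : hilbertType C).

Definition pairdot (x y : H1 * H2) : C := '[x.1, y.1] + '[x.2, y.2].

Lemma pairdot_bilinear : bilinear_for *%R (Num.conj \; *%R) pairdot.
Proof.
split=> [w|w] a u v; rewrite /pairdot /=.
  by rewrite !linearPl mulrDr addrACA.
by rewrite !linearPr mulrDr addrACA.
Qed.
HB.instance Definition _ := bilinear_isBilinear.Build C _ _ _ *%R
  (Num.conj \; *%R) pairdot pairdot_bilinear.

Lemma pairdot_hermitian u v : pairdot u v = (-1) ^+ false * (pairdot v u)^*.
Proof.
rewrite expr0 mul1r /pairdot rmorphD /=.
by rewrite (hermC _ u.1) (hermC _ u.2) expr0 !mul1r.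
Qed.
HB.instance Definition _ := isHermitianSesquilinear.Build C _ false
  Num.conj pairdot pairdot_hermitian.

Lemma pairdot_gt0 u : u != 0 -> 0 < pairdot u u.
Proof.
case: u => u v; rewrite /pairdot -pair_eqE negb_and /= => /orP[u0|v0].
  by rewrite ltr_wpDr ?neq0_dnorm_gt0 ?dnorm_ge0.
by rewrite ltr_wpDl ?neq0_dnorm_gt0 ?dnorm_ge0.
Qed.
HB.instance Definition _ := isDotProduct.Build C _ pairdot pairdot_gt0.

HB.instance Definition _ := Vector_isHilbert.Build C (H1 * H2)%type pairdot.

End DirectSum.

Section Adjoint.
Variables (C : numClosedFieldType) (U V : hilbertType C).

Definition adj (f : 'Hom(U, V)) : 'Hom(V, U) :=
  xget 0 [set g : 'Hom(V, U) | forall x y, '[f x, y] = '[x, g y]]%classic.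

Lemma inner_injr (H : hilbertType C) (u v : H) :
  (forall x, '[x, u] = '[x, v]) -> u = v.
Proof.
move=> uv; apply/eqP; rewrite -subr_eq0; apply/negPn/negP => /(@neq0_dnorm_gt0 _ _ _ inner).
by rewrite linearBr /= uv subrr ltxx.
Qed.

Lemma adj_ex (f : 'Hom(U, V)) :
  exists g : 'Hom(V, U), forall x y, '[f x, y] = '[x, g y].
Proof.
pose n := \dim {:U}; pose e := vbasis {:U}.
have ebasis : basis_of fullv e := vbasisP _.
have efree := basis_free ebasis.
pose G : 'M[C]_n := \matrix_(i, j) '[e`_i, e`_j].
have Gunit : G \in unitmx.
  rewrite -row_free_unit -kermx_eq0; apply/eqP/row_matrixP => k.
  set v := row k _; rewrite row0.
  have vG : v *m G = 0 by apply/sub_kermxP; exact: row_sub.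
  pose x := \sum_(i < n) v 0 i *: e`_i.
  have xe (j : 'I_n) : '[x, e`_j] = 0.
    have /rowP/(_ j) := vG; rewrite mxE [in RHS]mxE => <-.
    rewrite linear_sumlz; apply: eq_bigr => i _.
    by rewrite linearZl_LR [G _ _]mxE.
  have x0 : x = 0.
    apply/eqP/negPn/negP => /(@neq0_dnorm_gt0 _ _ _ inner).
    rewrite {2}/x linear_sumr big1 ?ltxx // => j _.
    by rewrite linearZr_LR /= xe mulr0.
  apply/rowP => i; rewrite [RHS]mxE; exact: (freeP efree (fun i => v 0 i) x0 i).
pose c (y : V) : 'cV[C]_n := \col_i (\sum_j invmx G i j * '[f e`_j, y])^*.
pose g (y : V) : U := \sum_(i < n) c y i 0 *: e`_i.
have glin : linear g.
  move=> a y z; rewrite /g scaler_sumr -big_split; apply: eq_bigr => i _ /=.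
  rewrite scalerA -scalerDl; congr (_ *: _); rewrite !mxE.
  rewrite -[X in X * _]conjCK -rmorphM -rmorphD mulr_sumr -big_split /=.
  congr (_^*); apply: eq_bigr => j _.
  by rewrite linearPr /= mulrDr mulrCA.
pose gL : {linear V -> U} :=
  HB.pack g (GRing.isLinear.Build _ _ _ _ g glin).
exists (linfun gL) => x y; rewrite lfunE /=.
have base (i : 'I_n) : '[f e`_i, y] = '[e`_i, g y].
  pose b : 'cV[C]_n := \col_j '[f e`_j, y].
  have -> : '[f e`_i, y] = (G *m (invmx G *m b)) i 0.
    by rewrite mulmxA mulmxV // mul1mx mxE.
  rewrite mxE linear_sumr; apply: eq_bigr => j _.
  rewrite linearZr_LR /= [c _ _ _]mxE conjCK [G _ _]mxE mulrC; congr (_ * _).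
  by rewrite mxE; apply: eq_bigr => k _; rewrite [b _ _]mxE.
rewrite (coord_basis ebasis (memvf x)) linear_sum !linear_sumlz.
by apply: eq_bigr => i _; rewrite linearZ /= !linearZl_LR; congr (_ * _); exact: base.
Qed.

Lemma adjP (f : 'Hom(U, V)) x y : '[f x, y] = '[x, adj f y].
Proof. by rewrite /adj; case: xgetP => [g _ -> //|]; have [g] := adj_ex f => gP /(_ g)/(_ gP). Qed.

Lemma adjPr (f : 'Hom(U, V)) x y : '[adj f y, x] = '[y, f x].
Proof.
rewrite (hermC inner) (hermC inner y); congr (_ * _^*).
by rewrite -[LHS]adjP.
Qed.

End Adjoint.

(* Canonical L-systems with directing operator [J]; [J] is a parameter, so
   that only systems sharing it can be coupled. *)
Record Lsystem (C : numClosedFieldType) (H E : hilbertType C) (J : 'End(E)) :=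
  LSystem {
    main : 'End(H);
    channel : 'Hom(E, H);
    directing_selfadj : adj J = J;
    directing_unitary : (adj J \o J)%VF = \1%VF;
    Im_main : (2 * 'i)^-1 *: (main - adj main)
                = (channel \o J \o adj channel)%VF }.

Section Coupling.
Variables (C : numClosedFieldType) (H1 H2 E : hilbertType C) (J : 'End(E)).
Variables (S1 : Lsystem H1 J) (S2 : Lsystem H2 J).

Let T1 := main S1.
Let T2 := main S2.
Let K1 := channel S1.
Let K2 := channel S2.

Definition coupling_main_fun (x : H1 * H2) : H1 * H2 :=
  (T1 x.1 + (2 * 'i) *: K1 (J (adj K2 x.2)), T2 x.2).

Definition coupling_channel_fun (c : E) : H1 * H2 := (K1 c, K2 c).

Lemma coupling_main_linear : linear coupling_main_fun.
Proof.
move=> a x y; rewrite /coupling_main_fun; congr (_, _) => /=; last first.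
  exact: linearP.
by rewrite !linearP /= scalerDr addrACA.
Qed.
HB.instance Definition _ := GRing.isLinear.Build _ _ _ _ coupling_main_fun
  coupling_main_linear.

Lemma coupling_channel_linear : linear coupling_channel_fun.
Proof. by move=> a x y; rewrite /coupling_channel_fun !linearP. Qed.
HB.instance Definition _ := GRing.isLinear.Build _ _ _ _ coupling_channel_fun
  coupling_channel_linear.

Definition coupling_main : 'End((H1 * H2)%type) := linfun coupling_main_fun.
Definition coupling_channel : 'Hom(E, (H1 * H2)%type) :=
  linfun coupling_channel_fun.

Lemma coupling_Im :
  (2 * 'i)^-1 *: (coupling_main - adj coupling_main)
    = (coupling_channel \o J \o adj coupling_channel)%VF.
Proof.
have J_adj := directing_selfadj S1.
have ii0 : (2 * 'i : C) != 0 by rewrite mulf_neq0 ?pnatr_eq0 ?neq0Ci.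
have adjK x : adj coupling_channel x = adj K1 x.1 + adj K2 x.2.
  apply: inner_injr => c; rewrite -adjP linearDr /= -!adjP.
  by rewrite lfunE.
have adjT x : adj coupling_main x =
    (adj T1 x.1, adj T2 x.2 - (2 * 'i) *: K2 (J (adj K1 x.1))).
  apply: inner_injr => y; rewrite -adjP lfunE /=.
  rewrite [LHS]/(pairdot _ _) [RHS]/(pairdot _ _) /pairdot /=.
  rewrite linearDl linearBr /= linearZl_LR linearZr_LR /= -2!adjP.
  rewrite rmorphM /= conjCi conjC_nat mulrN mulNr opprK -addrA; congr (_ + _).
  rewrite addrC; congr (_ + _ * _).
  by rewrite -[RHS]adjPr [LHS]adjP [LHS]adjP J_adj.
apply/lfunP => x.
have := congr1 (fun f : 'End(H1) => f x.1) (Im_main S1).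
have := congr1 (fun f : 'End(H2) => f x.2) (Im_main S2).
rewrite !(scale_lfunE, comp_lfunE, add_lfunE, opp_lfunE) /= => E2 E1.
rewrite adjK adjT ![linfun _ _]lfunE /= /coupling_main_fun /coupling_channel_fun.
congr (_, _); rewrite !linearD /=.
  by rewrite scalerA mulVf // scale1r addrAC -scalerDr E1.
by rewrite opprB scalerBr scalerA mulVf // scale1r addrCA -scalerBr E2.
Qed.

(* The coupling S1 . S2 on the orthogonal sum of the state spaces. *)
Definition coupling : Lsystem (H1 * H2)%type J :=
  LSystem (directing_selfadj S1) (directing_unitary S1) coupling_Im.

End Coupling.

Section Entropy.
Variable R : realType.
Local Notation C := R[i].

(* W(z) = I - 2i K^* (T - z I)^-1 K J. The library inverse [^-1] is total; it
   is the inverse of T - z I exactly when z is in the resolvent set of T. *)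
Definition transfer (H E : hilbertType C) (J : 'End(E)) (S : Lsystem H J)
    (z : C) : 'End(E) :=
  \1%VF - (2 * 'i) *: (adj (channel S) \o (main S - z *: \1)^-1
                        \o channel S \o J)%VF.

Section FunctionalCalculus.
Variable E : hilbertType C.

(* phi(A) for a self-adjoint operator A: the operator acting as phi(a) on the
   eigenspace of A for each eigenvalue a. It is unique since the eigenspaces
   span E. *)
Definition fcalc (phi : C -> C) (A : 'End(E)) : 'End(E) :=
  xget 0 [set B : 'End(E) |
    forall (a : C) (v : E), A v = a *: v -> B v = phi a *: v]%classic.

Definition opabs (W : 'End(E)) : 'End(E) := fcalc sqrtC (adj W \o W)%VF.

(* Only meaningful for positive definite A, whose eigenvalues are positive
   reals. *)
Definition opln (A : 'End(E)) : 'End(E) :=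
  fcalc (fun a => (ln (complex.Re a))%:C%C) A.

Definition optr (A : 'End(E)) : C :=
  \tr (passmx.mxof (vbasis {:E}) (vbasis {:E}) A).

End FunctionalCalculus.

(* - tr ln |W(-i)|, with value +oo when W(-i) is singular, by the convention
   ln 0 = -oo. The trace of the self-adjoint operator ln |W(-i)| is real. *)
Definition centropy (H E : hilbertType C) (J : 'End(E)) (S : Lsystem H J) :
    \bar R :=
  let W := transfer S (- 'i) in
  if lker W == 0%VS then (- complex.Re (optr (opln (opabs W))))%:E else +oo%E.

End Entropy.

(* Diagonal systems on an orthonormal pair do exist. *)
Lemma diag_Lsystem_ex (R : realType) (H : hilbertType R[i]) (h1 h2 : H)
    (a b : R[i]) :
  orthonormal inner [:: h1; h2] ->
  0 <= complex.Im a -> 0 <= complex.Im b ->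
  exists S : @Lsystem R[i] H 'cV[R[i]]_2 \1%VF,
  [/\ main S h1 = a *: h1, main S h2 = b *: h2 &
      forall c : 'cV[R[i]]_2, channel S c
        = ((Num.sqrt (complex.Im a))%:C%C * c 0 0) *: h1
          + ((Num.sqrt (complex.Im b))%:C%C * c 1 0) *: h2].
Proof.
move=> horth a_ge0 b_ge0; have /andP[/= /and3P[/eqP n1 /eqP n2 _]] := horth.
rewrite !andbT => /eqP o12.
have o21 : '[h2, h1] = 0 by apply/eqP; rewrite herm_eq0C; apply/eqP.
pose sa := (Num.sqrt (complex.Im a))%:C%C.
pose sb := (Num.sqrt (complex.Im b))%:C%C.
have ssa : (2 * 'i)^-1 * (a - a^*) = sa * sa.
  rewrite -rmorphM /= -expr2 sqr_sqrtr // [X in _ - X]/(conjc _) subcJ.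
  rewrite [2 * _ * _]mulrAC mulKf //.
  by rewrite mulf_neq0 ?pnatr_eq0 ?neq0Ci.
have ssb : (2 * 'i)^-1 * (b - b^*) = sb * sb.
  rewrite -rmorphM /= -expr2 sqr_sqrtr // [X in _ - X]/(conjc _) subcJ.
  rewrite [2 * _ * _]mulrAC mulKf //.
  by rewrite mulf_neq0 ?pnatr_eq0 ?neq0Ci.
have sac : sa^* = sa by apply: (congr1 (Complex _)); rewrite oppr0.
have sbc : sb^* = sb by apply: (congr1 (Complex _)); rewrite oppr0.
pose D (p q : R[i]) (x : H) : H := (p * '[x, h1]) *: h1 + (q * '[x, h2]) *: h2.
have Dlin p q : linear (D p q).
  move=> k x y; rewrite /D !linearPl /= !mulrDr !scalerDl scalerDr !scalerA.
  by rewrite addrACA ![_ * (k * _)]mulrCA.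
pose DL p q : {linear H -> H} :=
  HB.pack (D p q) (GRing.isLinear.Build _ _ _ _ (D p q) (Dlin p q)).
pose k (c : 'cV[R[i]]_2) : H := (sa * c 0 0) *: h1 + (sb * c 1 0) *: h2.
have klin : linear k.
  move=> l x y; rewrite /k !mxE !mulrDr !scalerDl scalerDr !scalerA.
  by rewrite addrACA ![_ * (l * _)]mulrCA.
pose kL : {linear _ -> _} := HB.pack k (GRing.isLinear.Build _ _ _ _ k klin).
pose T := linfun (DL a b); pose K := linfun kL.
have adT x : adj T x = D a^* b^* x.
  apply: inner_injr => y; rewrite -adjP lfunE /= /D linearDl linearDr.
  rewrite !linearZl_LR !linearZr_LR /= !rmorphM /= !conjCK.
  have C u v : ('[u, v])^* = '[v, u] by rewrite [RHS]hermC expr0 mul1r.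
  by rewrite !C; congr (_ + _); rewrite mulrAC.
have adK x : adj K x = \col_i (if i == 0 then sa * '[x, h1] else sb * '[x, h2]).
  apply: inner_injr => y; rewrite -adjP lfunE /= /k.
  rewrite linearDl !linearZl_LR /= [RHS]/(cvdot _ _) /cvdot.
  have C u v : ('[u, v])^* = '[v, u] :> R[i] by rewrite [RHS]hermC expr0 mul1r.
  rewrite big_ord_recl big_ord1 !mxE /= !rmorphM /= sac sbc !C.
  have -> : lift 0 0 = 1 :> 'I_2 by apply/val_inj.
  by congr (_ + _); rewrite mulrAC mulrC.
have adJ : adj (\1%VF : 'End('cV[R[i]]_2)) = \1%VF.
  by apply/lfunP => x; apply: inner_injr => y; rewrite -adjP !lfunE.
have ImT : (2 * 'i)^-1 *: (T - adj T) = (K \o \1 \o adj K)%VF.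
  apply/lfunP => x.
  rewrite !(scale_lfunE, comp_lfunE, add_lfunE, opp_lfunE) id_lfunE adT adK.
  rewrite ![linfun _ _]lfunE /= /D /k !mxE /= opprD addrACA -!scalerBl.
  rewrite scalerDr !scalerA; congr (_ *: _ + _ *: _).
    by rewrite mulrA -ssa -mulrA.
  by rewrite mulrA -ssb -mulrA.
have adJJ : (adj (\1%VF : 'End('cV[R[i]]_2)) \o \1)%VF = \1%VF.
  by rewrite adJ comp_lfun1l.
exists (LSystem adJ adJJ ImT); split=> [||c] /=; rewrite lfunE //= /D.
  by rewrite n1 o12 mulr1 mulr0 scale0r addr0.
by rewrite n2 o21 mulr1 mulr0 scale0r add0r.
Qed.

(* Main.v *)
Require Import Defs.
From HB Require Import structures.
From mathcomp Require Import all_boot all_order all_algebra.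
From mathcomp Require Import sesquilinear.
From mathcomp Require Import classical_sets reals ereal exp.
From mathcomp Require Import complex.
Import Order.TTheory GRing.Theory Num.Theory.
Local Open Scope ring_scope.
Set Implicit Arguments.
Unset Strict Implicit.
Unset Printing Implicit Defensive.

(** The additivity rests on two facts.

    The transfer function of a coupling is the product of the transfer
    functions of its factors wherever both resolvents exist
    ([transfer_coupling]): the main operator of the coupling is block
    triangular, so with R1, R2 the resolvents of T1, T2 its resolvent has the
    off-diagonal block - 2i R1 K1 J K2^* R2, and compressing it by the channel
    operator gives exactly the mixed term of
    (I - 2i K1^* R1 K1 J) (I - 2i K2^* R2 K2 J).

    For the systems at hand, T_j is diagonal in the basis h01, h02 and K_j
    maps the standard basis of C^2 to multiples of h01, h02.  Hence W_j(-i) is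
    diagonal in the standard basis ([diag_along_transfer]); the resolvents at
    -i exist because all eigenvalues of T_j lie in the closed upper half
    plane.  When W is diagonal with entries w_i in an orthonormal basis, |W|
    and ln |W| are diagonal in that basis too, so the c-Entropy is
    - sum_i ln |w_i|, or +oo if some w_i vanishes ([centropy_diag_along]).  The
    diagonal entries of the coupling are products, one vanishes exactly when
    one of its two factors does, and otherwise the logarithm turns the
    products into sums.  The second claim follows since a c-Entropy is never
    -oo. *)

(** * Operators that are diagonal along a pair of bases *)

Section Diagonal.
Variables (F : fieldType) (n : nat).

(** The two families may live in different spaces: this covers the channel
    operator, which sends the standard basis of the external space to multiples
    of eigenvectors of the main operator. *)
Definition diag_along (U V : vectType F) (e : n.-tuple U) (f : n.-tuple V)
    (a : 'I_n -> F) (A : 'Hom(U, V)) :=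
  forall i : 'I_n, A e`_i = a i *: f`_i.

Lemma diag_along_comp (U V W : vectType F) (e : n.-tuple U) (f : n.-tuple V)
    (g : n.-tuple W) a b A B :
  diag_along e f a A -> diag_along f g b B ->
  diag_along e g (fun i => a i * b i) (B \o A)%VF.
Proof. by move=> dA dB i; rewrite comp_lfunE dA linearZ /= dB scalerA. Qed.

Section Basis.
Variables (U V : vectType F) (e : n.-tuple U) (f : n.-tuple V).
Hypothesis e_basis : basis_of fullv e.

Lemma diag_along_exists (a : 'I_n -> F) :
  exists A : 'Hom(U, V), diag_along e f a A.
Proof.
pose A v := \sum_i (a i * coord e i v) *: f`_i.
have A_lin : linear A.
  move=> k u v; rewrite /A scaler_sumr -big_split; apply: eq_bigr => i _ /=.
  by rewrite linearP mulrDr scalerDl scalerA mulrCA.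
pose AL : {linear U -> V} := HB.pack A (GRing.isLinear.Build _ _ _ _ A A_lin).
exists (linfun AL) => j; rewrite lfunE /= /A (bigD1 j) //= big1 ?addr0.
  by rewrite coord_free ?(basis_free e_basis) // eqxx mulr1.
move=> i /negPf j'i; rewrite coord_free ?(basis_free e_basis) //.
by rewrite eq_sym j'i mulr0 scale0r.
Qed.

Lemma diag_along_coord a A v : diag_along e f a A ->
  A v = \sum_i (a i * coord e i v) *: f`_i.
Proof.
move=> dA; rewrite {1}(coord_basis e_basis (memvf v)) linear_sum.
by apply: eq_bigr => i _; rewrite linearZ /= dA scalerA mulrC.
Qed.

Lemma diag_along_lker0 a A : free f -> diag_along e f a A ->
  (lker A == 0%VS) = [forall i, a i != 0].
Proof.
move=> f_free dA; apply/lker0P/forallP => [A_inj i|a0 u v].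
  apply/negP => /eqP ai0; have := dA i; rewrite ai0 scale0r => Ae0.
  have /eqP := A_inj _ _ (etrans Ae0 (esym (linear0 A))).
  by apply/negP/(free_not0 (basis_free e_basis))/mem_nth; rewrite size_tuple.
rewrite !(diag_along_coord _ dA) => uv.
rewrite (coord_basis e_basis (memvf u)) (coord_basis e_basis (memvf v)).
apply: eq_bigr => i _; congr (_ *: _); apply: (mulfI (a0 i)).
by move/(congr1 (coord f i)): uv; rewrite !coord_sum_free.
Qed.

End Basis.

Lemma diag_along_inv (U : vectType F) (e : n.-tuple U) a (A : 'End(U)) :
  basis_of fullv e -> (forall i, a i != 0) -> diag_along e e a A ->
  diag_along e e (fun i => (a i)^-1) (A^-1)%VF.
Proof.
move=> e_basis a0 dA i.
have kerA : lker A == 0%VS.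
  by rewrite (diag_along_lker0 e_basis (basis_free e_basis) dA); apply/forallP.
by rewrite -{1}[e`_i](scalerK (a0 i)) linearZ /= -dA lker0_lfunK.
Qed.

End Diagonal.

(** Writing A as A \o \1 through the eigenbasis and rotating the factors under
    the trace replaces the canonical basis of U by e. *)
Lemma trace_diag_along (F : fieldType) (U : vectType F) n
    (e : n.-tuple U) a (A : 'End(U)) :
  basis_of fullv e -> diag_along e e a A ->
  \tr (passmx.mxof (vbasis {:U}) (vbasis {:U}) A) = \sum_i a i.
Proof.
move=> e_basis; have nE := size_basis e_basis; move: e a e_basis.
case: n / nE => e a e_basis dA; have b_basis := vbasisP {:U}.
set b := vbasis _ in b_basis *.
rewrite -{1}[A]comp_lfun1r (passmx.mxof_comp b b e_basis) mxtrace_mulC.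
rewrite -(passmx.mxof_comp e e b_basis) comp_lfun1l; apply: eq_bigr => i _.
rewrite !mxE /= passmx.vecof_delta dA linearZ /= coord_free ?eqxx ?mulr1 //.
exact: basis_free e_basis.
Qed.

(** * Adjoints in orthonormal bases *)

Section Orthonormal.
Variables (C : numClosedFieldType) (n : nat).

Lemma orthonormal_tupleP (H : hilbertType C) (e : n.-tuple H) :
  reflect (forall i j : 'I_n, '[e`_i, e`_j] = (i == j)%:R)
          (orthonormal inner e).
Proof.
apply: (iffP orthonormalP) => [[e_uniq eo] i j|eo].
  by rewrite eo ?mem_nth ?size_tuple // nth_uniq ?size_tuple.
have e_uniq : uniq e.
  apply/(uniqP 0) => i j; rewrite !inE size_tuple => ltin ltjn eij.
  have := eo (Ordinal ltin) (Ordinal ltjn); rewrite -eij /=.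
  rewrite (eo (Ordinal ltin) (Ordinal ltin)) eqxx -val_eqE /=.
  by case: eqP => // _ /eqP; rewrite oner_eq0.
split=> // u v /(nthP 0)[i ltin <-] /(nthP 0)[j ltjn <-].
rewrite nth_uniq //; rewrite size_tuple in ltin ltjn.
exact: (eo (Ordinal ltin) (Ordinal ltjn)).
Qed.

Variables (U V : hilbertType C) (e : n.-tuple U) (f : n.-tuple V).
Hypotheses (e_basis : basis_of fullv e).
Hypotheses (e_ortho : orthonormal inner e) (f_ortho : orthonormal inner f).

Lemma diag_along_adj a (A : 'Hom(U, V)) :
  diag_along e f a A -> diag_along f e (fun i => (a i)^*) (adj A).
Proof.
move=> dA i; apply: inner_injr => x; rewrite -adjP.
rewrite (coord_basis e_basis (memvf x)) linear_sum !linear_sumlz.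
apply: eq_bigr => j _; rewrite linearZ !linearZl_LR /= dA.
rewrite linearZl_LR linearZr_LR /= conjCK; congr (_ * _).
move/orthonormal_tupleP: e_ortho => ->; move/orthonormal_tupleP: f_ortho => ->.
by case: eqP => [->|_]; rewrite ?mulr1 ?mulr0.
Qed.

End Orthonormal.

(** * The transfer function of a coupling *)

Section TransferCoupling.
Variables (R : realType) (H1 H2 E : hilbertType R[i]) (J : 'End(E)).
Variables (S1 : Lsystem H1 J) (S2 : Lsystem H2 J).

Lemma adj_coupling_channel x :
  adj (coupling_channel S1 S2) x = adj (channel S1) x.1 + adj (channel S2) x.2.
Proof.
apply: inner_injr => c; rewrite -adjP linearDr /= -!adjP.
by rewrite lfunE.
Qed.

(** Back substitution for the block triangular main operator: the second
    component of the solution is found first and then fed into the equation for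
    the first one. *)
Lemma coupling_resolvent z (x : H1 * H2) :
  lker (main S1 - z *: \1%VF) == 0%VS -> lker (main S2 - z *: \1%VF) == 0%VS ->
  let v := (main S2 - z *: \1)^-1%VF x.2 in
  (main (coupling S1 S2) - z *: \1)^-1%VF x =
    ((main S1 - z *: \1)^-1%VF
       (x.1 - (2 * 'i) *: channel S1 (J (adj (channel S2) v))), v).
Proof.
move=> ker1 ker2 v.
have TzE y : (main (coupling S1 S2) - z *: \1)%VF y =
    ((main S1 - z *: \1)%VF y.1
       + (2 * 'i) *: channel S1 (J (adj (channel S2) y.2)),
     (main S2 - z *: \1)%VF y.2).
  rewrite !(add_lfunE, opp_lfunE, scale_lfunE) !id_lfunE.
  rewrite [main _]/(coupling_main _ _) lfunE.
  by rewrite /= /coupling_main_fun; congr (_, _); rewrite /= addrAC.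
have ker : lker (main (coupling S1 S2) - z *: \1%VF) == 0%VS.
  rewrite -subv0; apply/subvP => -[y1 y2]; rewrite memv_ker TzE memv0.
  case/eqP => /= [y1E y2E].
  have y20 : y2 = 0 by apply/eqP; rewrite -memv0 -(eqP ker2) memv_ker y2E.
  move: y1E; rewrite y20 !linear0 addr0 => y1E.
  have y10 : y1 = 0 by apply/eqP; rewrite -memv0 -(eqP ker1) memv_ker y1E.
  by rewrite y10.
set y := (_, _); have <- : (main (coupling S1 S2) - z *: \1)%VF y = x.
  by rewrite TzE !lker0_lfunVK //= subrK; case: x @v @y.
exact: lker0_lfunK.
Qed.

(** The off-diagonal block of the resolvent contributes the mixed term
    (2i)^2 K1^* R1 K1 J K2^* R2 K2 J of the product. *)
Lemma transfer_coupling z :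
  lker (main S1 - z *: \1%VF) == 0%VS -> lker (main S2 - z *: \1%VF) == 0%VS ->
  transfer (coupling S1 S2) z = (transfer S1 z \o transfer S2 z)%VF.
Proof.
move=> ker1 ker2; apply/lfunP => c; rewrite /transfer.
rewrite !(comp_lfunE, add_lfunE, opp_lfunE, scale_lfunE, id_lfunE).
rewrite coupling_resolvent // [channel _]/(coupling_channel _ _).
rewrite adj_coupling_channel lfunE /= !(linearB, linearD, linearZ, linearN) /=.
by rewrite -[RHS]addrA -scalerDr; congr (_ + _ *: _); rewrite addrC.

Qed.

End TransferCoupling.

(** * The c-Entropy of a system with diagonal transfer function *)

Section DiagonalSystems.
Variables (R : realType) (n : nat).

(** [fcalc] is a choice among the operators acting as phi l on the l-eigenspace
    of A.  One exists, namely the diagonal operator with entries phi (a i): an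
    eigenvector for l is supported on the indices i with a i = l.  The chosen
    one agrees with it because every vector of e is an eigenvector. *)
Lemma diag_along_fcalc (E : hilbertType R[i]) (e : n.-tuple E) phi a
    (A : 'End(E)) :
  basis_of fullv e -> diag_along e e a A ->
  diag_along e e (fun i => phi (a i)) (fcalc phi A).
Proof.
move=> e_basis dA; rewrite /fcalc; case: xgetP => [B _ BP i|noB].
  exact: BP (dA i).
have [B dB] := diag_along_exists e e_basis (fun i => phi (a i)).
case: (noB B) => l v Av; rewrite (diag_along_coord e_basis _ dB).
rewrite [in RHS](coord_basis e_basis (memvf v)) scaler_sumr.
apply: eq_bigr => i _; rewrite scalerA; congr (_ *: _).
have /eqP := congr1 (coord e i) Av.
rewrite (diag_along_coord e_basis _ dA) linearZ /=.
rewrite coord_sum_free ?(basis_free e_basis) //.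
have [-> _|vi0] := eqVneq (coord e i v) 0; first by rewrite !mulr0.
by move=> /eqP /(mulIf vi0) ->.
Qed.

Lemma diag_along_opabs (E : hilbertType R[i]) (e : n.-tuple E) w
    (W : 'End(E)) :
  basis_of fullv e -> orthonormal inner e -> diag_along e e w W ->
  diag_along e e (fun i => `|w i|) (opabs W).
Proof.
move=> e_basis e_ortho dW i.
have dWW := diag_along_comp dW (diag_along_adj e_basis e_ortho e_ortho dW).
by rewrite (diag_along_fcalc sqrtC e_basis dWW) -normCK sqrCK.
Qed.

Lemma centropy_diag_along (H E : hilbertType R[i]) (J : 'End(E))
    (S : Lsystem H J) (e : n.-tuple E) w :
  basis_of fullv e -> orthonormal inner e ->
  diag_along e e w (transfer S (- 'i)) ->
  centropy S = if [forall i, w i != 0]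
               then (- \sum_i ln (complex.Re `|w i|))%:E else +oo%E.
Proof.
move=> e_basis e_ortho dW; rewrite /centropy.
rewrite (diag_along_lker0 e_basis (basis_free e_basis) dW).
case: ifP => // _; rewrite /optr /opln.
have dabs := diag_along_opabs e_basis e_ortho dW.
rewrite (trace_diag_along e_basis (diag_along_fcalc _ e_basis dabs)) /=.
by rewrite -rmorph_sum.
Qed.

Lemma diag_along_shift (H : hilbertType R[i]) (h : n.-tuple H) t (T : 'End(H))
    z :
  diag_along h h t T -> diag_along h h (fun i => t i - z) (T - z *: \1%VF).
Proof.
move=> dT i; rewrite add_lfunE opp_lfunE scale_lfunE id_lfunE dT.
by rewrite scalerBl.
Qed.

Lemma diag_along_regular (H : hilbertType R[i]) (h : n.-tuple H) t
    (T : 'End(H)) z :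
  basis_of fullv h -> diag_along h h t T -> (forall i, t i != z) ->
  lker (T - z *: \1%VF) == 0%VS.
Proof.
move=> h_basis /(diag_along_shift z) dTz tz.
rewrite (diag_along_lker0 h_basis (basis_free h_basis) dTz).
by apply/forallP => i; rewrite subr_eq0.
Qed.

(** Here the main operator is normal with eigenbasis h and the channel matches
    e with h, so the system splits into one-dimensional ones, whose transfer
    functions are the entries. *)
Lemma diag_along_transfer (H E : hilbertType R[i])
    (S : @Lsystem _ H E \1%VF) (h : n.-tuple H) (e : n.-tuple E) t k z :
  basis_of fullv h -> basis_of fullv e ->
  orthonormal inner h -> orthonormal inner e ->
  diag_along h h t (main S) -> diag_along e h k (channel S) ->
  (forall i, t i != z) ->
  diag_along e e (fun i => 1 - (2 * 'i) * (`|k i| ^+ 2 / (t i - z)))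
    (transfer S z).
Proof.
move=> h_basis e_basis h_ortho e_ortho dT dK tz.
have dTz := diag_along_shift z dT.
have tz0 i : t i - z != 0 by rewrite subr_eq0.
have dR := diag_along_inv h_basis tz0 dTz.
have dKs := diag_along_adj e_basis e_ortho h_ortho dK.
move=> i; rewrite add_lfunE opp_lfunE scale_lfunE comp_lfun1r id_lfunE.
rewrite (diag_along_comp dK (diag_along_comp dR dKs)).
rewrite scalerA scalerBl scale1r normCK [_^-1 * _]mulrC.
by rewrite [in LHS](mulrA (k i)).
Qed.

Lemma Re_normM (x y : R[i]) :
  complex.Re `|x * y| = complex.Re `|x| * complex.Re `|y|.
Proof. by rewrite normrM !normc_def /= mulr0 subr0. Qed.

Lemma ln_normM (x y : R[i]) : x != 0 -> y != 0 ->
  ln (complex.Re `|x * y|) = ln (complex.Re `|x|) + ln (complex.Re `|y|).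
Proof.
move=> x0 y0; rewrite Re_normM lnM // posrE.
  by move: x0; rewrite -normr_gt0 ltcE => /andP[].
by move: y0; rewrite -normr_gt0 ltcE => /andP[].
Qed.

(** Diagonality in a common orthonormal basis makes the moduli multiplicative:
    |W1 W2| is diagonal with entries |w1 i| |w2 i|. *)
Lemma centropy_coupling_diag (H1 H2 E : hilbertType R[i]) (J : 'End(E))
    (S1 : Lsystem H1 J) (S2 : Lsystem H2 J) (e : n.-tuple E) w1 w2 :
  lker (main S1 - (- 'i) *: \1%VF) == 0%VS ->
  lker (main S2 - (- 'i) *: \1%VF) == 0%VS ->
  basis_of fullv e -> orthonormal inner e ->
  diag_along e e w1 (transfer S1 (- 'i)) ->
  diag_along e e w2 (transfer S2 (- 'i)) ->
  centropy (coupling S1 S2) = (centropy S1 + centropy S2)%E.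
Proof.
move=> ker1 ker2 e_basis e_ortho dW1 dW2.
have dW := diag_along_comp dW2 dW1; rewrite -transfer_coupling // in dW.
rewrite (centropy_diag_along e_basis e_ortho dW).
rewrite (centropy_diag_along e_basis e_ortho dW1).
rewrite (centropy_diag_along e_basis e_ortho dW2).
have -> : [forall i, w2 i * w1 i != 0] =
          [forall i, w1 i != 0] && [forall i, w2 i != 0].
  apply/forallP/andP => [w0|[/forallP w10 /forallP w20] i].
    split; apply/forallP => i; have := w0 i; rewrite mulf_eq0 negb_or.
      by case/andP.
    by case/andP.
  by rewrite mulf_neq0.
case: forallP => [w10|_]; case: forallP => [w20|_] //=.
rewrite -EFinD -opprD -big_split; congr (- _)%:E; apply: eq_bigr => i _ /=.
by rewrite mulrC ln_normM.
Qed.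

End DiagonalSystems.

(** * The systems of the theorem *)

Lemma delta_col_basis (C : numClosedFieldType) n :
  let e := [tuple delta_mx i 0 : 'cV[C]_n | i < n] in
  basis_of fullv e /\ orthonormal inner e.
Proof.
move=> e; have e_ortho : orthonormal inner e.
  apply/orthonormal_tupleP => i j; rewrite -!tnth_nth !tnth_mktuple.
  rewrite [LHS]/(cvdot _ _) /cvdot (bigD1 i) //= big1 => [|k /negPf ki].
    by rewrite !mxE !eqxx mul1r conjC_nat addr0 andbT.
  by rewrite !mxE ki mul0r.
split=> //; rewrite basisEfree (orthonormal_free e_ortho) subvf size_tuple.
by rewrite dimvf /dim /= muln1 leqnn.
Qed.

Lemma neq_opp_i (R : realType) (t : R[i]) : 0 <= complex.Im t -> t != - 'i.
Proof.
move=> t0; apply: contraTneq t0 => ->.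
by rewrite /= -ltNge oppr_lt0 ltr01.
Qed.

Theorem theorem13 (R : realType) (H : hilbertType R[i]) (h01 h02 : H)
    (lam1 lam2 mu1 mu2 : R[i])
    (S1 S2 : @Lsystem R[i] H 'cV[R[i]]_2 \1%VF) :
  \dim {:H} = 2%N ->
  basis_of {:H} [:: h01; h02] -> orthonormal inner [:: h01; h02] ->
  0 < complex.Im lam1 -> 0 < complex.Im lam2 ->
  0 <= complex.Im mu1 -> 0 <= complex.Im mu2 ->
  main S1 h01 = lam1 *: h01 -> main S1 h02 = mu1 *: h02 ->
  main S2 h01 = lam2 *: h01 -> main S2 h02 = mu2 *: h02 ->
  (forall c : 'cV[R[i]]_2, channel S1 c
     = ((Num.sqrt (complex.Im lam1))%:C%C * c 0 0) *: h01
       + ((Num.sqrt (complex.Im mu1))%:C%C * c 1 0) *: h02) ->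
  (forall c : 'cV[R[i]]_2, channel S2 c
     = ((Num.sqrt (complex.Im lam2))%:C%C * c 0 0) *: h01
       + ((Num.sqrt (complex.Im mu2))%:C%C * c 1 0) *: h02) ->
  (centropy (coupling S1 S2) = centropy S1 + centropy S2)%E
  /\ (centropy S1 = +oo%E \/ centropy S2 = +oo%E ->
      centropy (coupling S1 S2) = +oo%E).
Proof.
move=> _ h_basis h_ortho lam1_gt0 lam2_gt0 mu1_ge0 mu2_ge0.
move=> T1h1 T1h2 T2h1 T2h2 K1E K2E.
pose h : 2.-tuple H := [tuple h01; h02].
pose e := [tuple delta_mx i 0 : 'cV[R[i]]_2 | i < 2].
have [e_basis e_ortho] : basis_of fullv e /\ orthonormal inner e.
  exact: delta_col_basis.
pose diag2 (a b : R[i]) (i : 'I_2) := if i == 0 then a else b.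
have diag_of (S : @Lsystem R[i] H 'cV[R[i]]_2 \1%VF) (a b : R[i]) :
    0 <= complex.Im a -> 0 <= complex.Im b ->
    main S h01 = a *: h01 -> main S h02 = b *: h02 ->
    (forall c : 'cV[R[i]]_2, channel S c
       = ((Num.sqrt (complex.Im a))%:C%C * c 0 0) *: h01
         + ((Num.sqrt (complex.Im b))%:C%C * c 1 0) *: h02) ->
    lker (main S - (- 'i) *: \1%VF) == 0%VS /\
    exists w, diag_along e e w (transfer S (- 'i)).
  move=> a_ge0 b_ge0 Ta Tb KE.
  have dT : diag_along h h (diag2 a b) (main S).
    by case=> -[|[|//]] lti.
  have dK : diag_along e h (diag2 (Num.sqrt (complex.Im a))%:C%C
                                  (Num.sqrt (complex.Im b))%:C%C) (channel S).
    move=> i; rewrite -tnth_nth tnth_mktuple KE !mxE /diag2 -!val_eqE andbT.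
    by case: i => -[|[|//]] lti; rewrite /= !(mulr1, mulr0)
      scale0r ?addr0 ?add0r.
  have ab_z i : diag2 a b i != - 'i.
    by rewrite /diag2; case: ifP; rewrite neq_opp_i.
  split; first exact: diag_along_regular h_basis dT ab_z.
  by eexists; exact: diag_along_transfer dT dK ab_z.
have [ker1 [w1 dW1]] := diag_of _ _ _ (ltW lam1_gt0) mu1_ge0 T1h1 T1h2 K1E.
have [ker2 [w2 dW2]] := diag_of _ _ _ (ltW lam2_gt0) mu2_ge0 T2h1 T2h2 K2E.
have SE := centropy_coupling_diag ker1 ker2 e_basis e_ortho dW1 dW2.
by split=> //; rewrite SE => -[->|->]; rewrite /centropy; case: ifP.
Qed.
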